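(* There exists $x_0$ such that for every real $x\geq x_0$ and every integer $k$ with $1\leqslant k\leqslant \log x/(5\log\log x)$, there are at least $x^{1/10}$ distinct positive integers $n\leqslant x$ with $\kappa_+(n)\geqslant k$.
   Context: Every integer $n\ge 1$ is assigned a finite rooted planar tree $t(n)$ (its prime tower factorization): $t(1)$ is the tree with a single vertex (the root) and no edges; if $n=p_1^{a_1}\cdots p_s^{a_s}$ with primes $p_1<\dots<p_s$ and $a_i\ge1$, then $t(n)$ consists of a root with $s$ edges to children, ordered from left to right, the $i$-th edge leading to a copy of the planar tree $t(a_i)$ rooted at that child. For integers $n\ge1$ and $K\ge0$ we say the observable $O(n,n+1,\ldots,n+K)$ occurs at $m\ge1$ if $t(m+j)=t(n+j)$ for all $0\le j\le K$. $\kappa_+(n)$ is the least natural number $K$ such that $O(n,n+1,\ldots,n+K)$ occurs only at $m=n$; this is well defined for all $n\ge 1$. *)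

(* Defs.v *)
From mathcomp Require Import all_boot boolp zify.

Set Implicit Arguments.
Unset Strict Implicit.
Unset Printing Implicit Defensive.

(* Finite rooted planar trees: a root with the left-to-right list of the
   subtrees at its children. *)
Inductive ptree : Type := PNode of seq ptree.

(* [prime_decomp n] lists the pairs (p_i, a_i) with p_1 < p_2 < ...  The
   recursion is on exponents, which are smaller than n, so that fuel n
   suffices: see the defining equation [ptfE]. *)
Fixpoint ptf_rec (d n : nat) : ptree :=
  if d is d'.+1 then PNode [seq ptf_rec d' pa.2 | pa <- prime_decomp n]
  else PNode [::].

Definition ptf (n : nat) : ptree := ptf_rec n n.

Lemma ptf_rec_fuel (d n : nat) : n <= d -> ptf_rec d n = ptf n.
Proof.
rewrite /ptf; elim/ltn_ind: n d => -[|n] IH [|d] //= le_nd.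
congr PNode; apply/eq_in_map => -[p a] /= /mem_prime_decomp[pr_p a0 dvd_pa].
have le_pa := dvdn_leq (ltn0Sn n) dvd_pa.
have lt_a : a < n.+1 by apply: leq_trans le_pa; exact: ltn_expl (prime_gt1 pr_p).
by rewrite (IH a lt_a d) ?(IH a lt_a n) //; lia.
Qed.

Lemma ptfE (n : nat) : ptf n = PNode [seq ptf pa.2 | pa <- prime_decomp n].
Proof.
case: n => [|n] //; rewrite {1}/ptf /=; congr PNode.
apply/eq_in_map => -[p a] /= /mem_prime_decomp[pr_p a0 dvd_pa].
have le_pa := dvdn_leq (ltn0Sn n) dvd_pa.
apply: ptf_rec_fuel.
by rewrite -ltnS; apply: leq_trans le_pa; exact: ltn_expl (prime_gt1 pr_p).
Qed.

(* The observable O(n, n+1, ..., n+K) occurs at m. *)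
Definition occurs (n K m : nat) : Prop :=
  0 < m /\ forall j, j <= K -> ptf (m + j) = ptf (n + j).

Definition occurs_only_at_self (n K : nat) : Prop :=
  forall m, occurs n K m -> m = n.

Lemma ptf_pfactor (p e : nat) : prime p -> 0 < e ->
  ptf (p ^ e) = PNode [:: ptf e].
Proof.
move=> pr_p e0.
by rewrite ptfE prime_decompE primesX // primes_prime //= pfactorK.
Qed.

Lemma ptf_pfactor_inv (x : nat) (c : ptree) : 0 < x -> ptf x = PNode [:: c] ->
  exists p e, [/\ prime p, 0 < e, x = p ^ e & ptf e = c].
Proof.
move=> x0; rewrite ptfE.
have := prod_prime_decomp x0; have := @mem_prime_decomp x.
case: prime_decomp => [|[p e] [|? ?]] //= mem_pd -> [<-].
have [pr_p e0 _] := mem_pd p e (mem_head _ _).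
by exists p, e; rewrite big_seq1.
Qed.

Lemma ptf_prime_inv (x p : nat) : 0 < x -> prime p -> ptf x = ptf p -> prime x.
Proof.
move=> x0 pr_p; rewrite -{1}(expn1 p) ptf_pfactor //.
move=> /(ptf_pfactor_inv x0)[q [e [pr_q e0 -> ]]].
rewrite ptfE; have := prod_prime_decomp e0.
by case: prime_decomp => // -> _; rewrite big_nil expn1.
Qed.

Lemma even_pfactor (p e : nat) : prime p -> ~~ odd (p ^ e) -> p = 2.
Proof. by move=> /even_prime[//|podd]; rewrite oddX podd orbT. Qed.

Lemma kappa_plus_ex (n : nat) : exists K, `[< occurs_only_at_self n K >].
Proof.
have [p n_p pr_p] := prime_above (n + 2).
have [q p_q pr_q] := prime_above p.
have n_a : n.+1 < 2 ^ n.+1 by exact: ltn_expl.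
set a := n.+1 in n_a; have a0 : 0 < a by [].
exists (q + 2 ^ a.+1); apply/asboolP => m [m0 occ].
have occ' x : n <= x <= q + 2 ^ a.+1 -> ptf (m + (x - n)) = ptf x.
  by move=> /andP[nx xq]; rewrite occ ?subnKC //; lia.
have pr_mp : prime (m + (p - n)).
  by apply: (ptf_prime_inv _ pr_p); [lia|apply: occ'; lia].
have pr_mq : prime (m + (q - n)).
  by apply: (ptf_prime_inv _ pr_q); [lia|apply: occ'; lia].
have odd_q : odd q by have [|//] := even_prime pr_q; lia.
have odd_mq : odd (m + (q - n)).
  by have [|//] := even_prime pr_mq; have := prime_gt1 pr_mp; lia.
have par : odd m = odd n by move: odd_mq; rewrite oddD oddB ?odd_q; [|lia]; lia.
have eS : 2 ^ a.+1 = 2 ^ a + 2 ^ a by rewrite expnS; lia.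
have odd_2a : odd (2 ^ a) = false by rewrite oddX.
have : ptf (m + (2 ^ a - n)) = PNode [:: ptf a].
  by rewrite -(@ptf_pfactor 2) //; apply: occ'; lia.
move=> /ptf_pfactor_inv-/(_ ltac:(lia))[s [b [pr_s b0 Eb _]]].
have : ptf (m + (2 ^ a.+1 - n)) = PNode [:: ptf a.+1].
  by rewrite -(@ptf_pfactor 2) //; apply: occ'; lia.
move=> /ptf_pfactor_inv-/(_ ltac:(lia))[r [c [pr_r c0 Ec _]]].
have r2 : r = 2 by apply: (even_pfactor pr_r (e := c)); lia.
have s2 : s = 2 by apply: (even_pfactor pr_s (e := b)); lia.
subst r s.
have Ebc : 2 ^ b + 2 ^ a = 2 ^ c by rewrite -Ec -Eb; lia.
suff ba : b = a by move: Eb; rewrite ba; lia.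
have lt_bc : b < c by rewrite -(ltn_exp2l b c (isT : 1 < 2)) -Ebc; lia.
have lt_ac : a < c.
  by rewrite -(ltn_exp2l a c (isT : 1 < 2)) -Ebc -[X in X < _]add0n ltn_add2r expn_gt0.
have le_bc : 2 ^ b.+1 <= 2 ^ c by rewrite leq_exp2l.
have le_ac : 2 ^ a.+1 <= 2 ^ c by rewrite leq_exp2l.
apply/eqP; rewrite -(eqn_exp2l b a (isT : 1 < 2)).
by move: le_bc le_ac; rewrite -Ebc !expnS; lia.
Qed.

Definition kappa_plus (n : nat) : nat := ex_minn (kappa_plus_ex n).

Lemma kappa_plusP (n : nat) : occurs_only_at_self n (kappa_plus n) /\
  forall K, occurs_only_at_self n K -> kappa_plus n <= K.
Proof.
rewrite /kappa_plus; case: ex_minnP => K /asboolP HK min.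
by split=> // K' HK'; apply/min/asboolP.
Qed.

(* Main.v *)
Require Import Defs.
From mathcomp Require Import all_boot all_order all_algebra.
From mathcomp Require Import all_classical all_reals all_analysis.
From mathcomp Require Import zify ring lra.

(** A window of length k whose sequence of trees also occurs elsewhere forces
    kappa_plus >= k, so the proof is a pigeonhole on windows with few possible
    patterns.  Put M = k!^2 and look at the windows M r + 1, ..., M r + k.  Then
    M r + j = j u with u = 1 mod k!, so the primes of u all exceed k and come
    after those of j; if moreover u is squarefree, then t(M r + j) depends only
    on j and on the number of primes of u, which is O(log x).  Hence there are
    at most (log x)^(2k) <= x^(2/5) patterns.  On the other hand, sieving out
    the squares m^2 with m > k shows that, of the Q = x / M >= x^(3/5) values of
    r, at least Q / (2k + 1) - k x^(1/2) make all k cofactors squarefree. *)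

Set Implicit Arguments.
Unset Strict Implicit.
Unset Printing Implicit Defensive.

Import Order.TTheory GRing.Theory Num.Theory.

(** * Trees of products with a squarefree factor *)

Lemma primes_mul_lt (j u : nat) : 0 < j -> 0 < u ->
    (forall p q, p \in primes j -> q \in primes u -> p < q) ->
  primes (j * u) = primes j ++ primes u.
Proof.
move=> j0 u0 lt_ju.
apply: (irr_sorted_eq ltn_trans ltnn (sorted_primes _)).
  rewrite (sorted_pairwise ltn_trans) pairwise_cat.
  rewrite -!(sorted_pairwise ltn_trans) !sorted_primes !andbT.
  by apply/allrelP => p q; exact: lt_ju.
by move=> p; rewrite mem_cat primesM.
Qed.

(** The primes of [j] are the smaller ones, so their subtrees stand on the left; those of [u] have
    exponent 1 and give leaves. Only the number of primes of [u] is visible. *)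
Lemma ptf_mul_squarefree (j u : nat) : 0 < j -> 0 < u ->
    (forall p q, p \in primes j -> q \in primes u -> p < q) ->
    (forall p, p \in primes u -> ~~ (p ^ 2 %| u)) ->
  ptf (j * u) = PNode ([seq ptf (logn p j) | p <- primes j]
                       ++ nseq (size (primes u)) (ptf 1)).
Proof.
move=> j0 u0 lt_ju sqf_u.
rewrite ptfE prime_decompE -map_comp primes_mul_lt // map_cat.
congr (PNode (_ ++ _)).
  apply/eq_in_map => p pj /=; rewrite lognM //.
  have : p \notin primes u.
    by apply/negP => pu; have := lt_ju _ _ pj pu; rewrite ltnn.
  by rewrite -logn_gt0 -eqn0Ngt => /eqP ->; rewrite addn0.
have -> : nseq (size (primes u)) (ptf 1) = [seq ptf 1 | _ <- primes u].
  by elim: (primes u) => //= _ s ->.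
apply/eq_in_map => q qu /=; rewrite lognM //.
have : q \notin primes j.
  by apply/negP => qj; have := lt_ju _ _ qj qu; rewrite ltnn.
rewrite -logn_gt0 -eqn0Ngt => /eqP ->; rewrite add0n; congr ptf.
have pr_q : prime q by move: qu; rewrite mem_primes => /andP[].
apply/eqP; rewrite eqn_leq logn_gt0 qu andbT.
by rewrite leqNgt -pfactor_dvdn // sqf_u.
Qed.

Lemma exp2_size_primes (u : nat) : 0 < u -> 2 ^ size (primes u) <= u.
Proof.
move=> u0; rewrite {2}(prod_prime_decomp u0) prime_decompE big_map /=.
have : all (fun p => 1 < p ^ logn p u) (primes u).
  apply/allP => p pu; move: (pu); rewrite mem_primes => /andP[pr_p _].
  by rewrite -(exp1n (logn p u)) ltn_exp2r ?logn_gt0 ?prime_gt1.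
elim: (primes u) => [|p s IH] /=; first by rewrite big_nil.
by move=> /andP[p1 /IH]; rewrite big_cons expnS; exact: leq_mul.
Qed.

(** * Elementary bounds and counting tools *)

Lemma fact_leq_exp (n : nat) : n`! <= n ^ n.
Proof.
elim: n => // n IH; rewrite factS expnS leq_mul2l /=.
by apply: leq_trans IH _; case: n => // n; rewrite leq_exp2r.
Qed.

(** The offsets up to [kappa_plus n] inclusive determine [n]; if [kappa_plus n < k], they would all
    lie among the [k] offsets shared with [m]. *)
Lemma kappa_plus_ge (n m k : nat) : 0 < m -> m != n ->
  (forall i, i < k -> ptf (m + i) = ptf (n + i)) -> k <= kappa_plus n.
Proof.
move=> m0 /eqP neq_mn eq_mn; rewrite leqNgt; apply/negP => lt_k.
apply/neq_mn/(kappa_plusP n).1; split=> // i le_i.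
exact/eq_mn/(leq_ltn_trans le_i).
Qed.

(** A divisor [d] of [a * r + 1] is coprime to [a], so the solutions [r] form at most one residue
    class mod [d], on which [r %/ d] is injective. *)
Lemma card_dvdn_affine (Q a d : nat) :
  #|[set r : 'I_Q | d %| (a * r).+1]| <= (Q %/ d).+1.
Proof.
have rd (r : 'I_Q) : r %/ d < (Q %/ d).+1.
  by rewrite ltnS leq_div2r // ltnW.
rewrite -[X in _ <= X]card_ord.
apply: (@leq_card_in _ _ (fun r : 'I_Q => Ordinal (rd r))) => r r'.
wlog le_rr : r r' / r' <= r.
  move=> W rS r'S E; case: (leqP r' r) => [/W|/ltnW/W]; first exact.
  by move=> W'; apply/esym/W'.
rewrite !inE => rS r'S [eq_div]; apply: val_inj => /=.
have co : coprime d a.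
  apply: coprime_dvdl rS _; rewrite coprime_sym.
  exact: coprime_dvdl (dvdn_mulr _ _) (coprimenS _).
have : d %| r - r'.
  by rewrite -(Gauss_dvdr _ co) mulnBr -subSS dvdn_sub.
rewrite -eqn_mod_dvd // => /eqP eq_mod.
by rewrite (divn_eq r d) eq_div eq_mod -divn_eq.
Qed.

Lemma card_bigcup_leq (I T : finType) (P : pred I) (F : I -> {set T}) :
  #|\bigcup_(i | P i) F i| <= \sum_(i | P i) #|F i|.
Proof.
elim/big_rec2: _ => [|i n A _ leA]; first by rewrite cards0.
by apply: leq_trans (leq_card_setU _ _) _; rewrite leq_add2l.
Qed.

(** On the elements of [A] that share their value with no other element of [A], [f] is injective. *)
Lemma card_noninjective (T U : finType) (A : {set T}) (f : T -> U) :
  #|A| <= #|[set x in A | [exists y in A, (y != x) && (f y == f x)]]| + #|U|.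
Proof.
set B := [set _ in A | _].
have sBA : B \subset A by apply/fintype.subsetP => x; rewrite inE => /andP[].
rewrite -(cardsID B A) (finset.setIidPr sBA) leq_add2l.
apply: (@leq_card_in _ _ f) => x y.
rewrite !inE => /andP[+ xA] /andP[_ yA] eq_f; rewrite xA /=.
move/existsPn/(_ y); rewrite yA eq_f eqxx andbT negbK.
by move/eqP.
Qed.

(* The midpoint bound 1/m^2 <= 1/(m - 1/2) - 1/(m + 1/2) telescopes; the crude
   value 1/k for the tail would leave nothing after k residue conditions. *)
Lemma sum_inv_sqr_leq (F : realFieldType) (k Y : nat) :
  (\sum_(k.+1 <= m < Y.+1) ((m ^ 2)%:R)^-1 <= 2 / (2 * k%:R + 1) :> F)%R.
Proof.
have pos (n : nat) : (0 < 2 * n%:R + 1 :> F)%R.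
  by rewrite ltr_wpDl // mulr_ge0 // ler0n.
have [le_kY|lt_Yk] := leqP k Y; last first.
  by rewrite big_geq 1?ltnW // divr_ge0 // ltW.
apply: (@le_trans _ _ (2 / (2 * k%:R + 1) - 2 / (2 * Y%:R + 1))%R); last first.
  by rewrite gerBl divr_ge0 // ltW.
elim: Y le_kY => [|Y IH] le_kY.
  by move: le_kY; rewrite leqn0 => /eqP ->; rewrite big_geq // subrr.
move: le_kY; rewrite leq_eqVlt => /orP[/eqP ->|lt_kY].
  by rewrite big_geq // subrr.
rewrite big_nat_recr //=; apply: le_trans (lerD (IH lt_kY) (lexx _)) _.
set y : F := Y%:R%R.
have y0 : (0 <= y)%R by rewrite ler0n.
have -> : ((Y.+1 ^ 2)%:R = (y + 1) ^+ 2 :> F)%R by rewrite natrX -natr1.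
have -> : (Y.+1%:R = y + 1 :> F)%R by rewrite -natr1.
rewrite -subr_ge0.
have -> : (2 / (2 * k%:R + 1) - 2 / (2 * (y + 1) + 1) -
    (2 / (2 * k%:R + 1) - 2 / (2 * y + 1) + ((y + 1) ^+ 2)^-1) =
    ((2 * y + 1) * (2 * y + 3) * (y + 1) ^+ 2)^-1)%R.
  by field; rewrite !lt0r_neq0 ?pos //; lra.
by rewrite invr_ge0 !mulr_ge0 // ?exprn_ge0 //; lra.
Qed.

(** * Windows with squarefree cofactors *)

Definition cofactor (k j r : nat) : nat := (k`! * (k`! %/ j) * r).+1.

Lemma cofactorE (k j r : nat) : 0 < j <= k ->
  k`! * k`! * r + j = j * cofactor k j r.
Proof.
move=> /andP[j0 jk]; rewrite /cofactor mulnS mulnA [j * (_ * _)]mulnCA.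
by rewrite [j * _]mulnC divnK ?dvdn_fact ?j0 // addnC.
Qed.

(** A prime up to [k] divides the factor [k!] untouched by the division by [j], hence the cofactor
    minus 1. This is why the modulus is the square of [k!]. *)
Lemma cofactor_prime_gt (k j r p : nat) : p \in primes (cofactor k j r) -> k < p.
Proof.
rewrite mem_primes => /and3P[pr_p _ dvd_p]; rewrite ltnNge; apply/negP => le_pk.
have dvd_pk : p %| k`! * (k`! %/ j) * r.
  by rewrite -mulnA dvdn_mulr // dvdn_fact // prime_gt0.
have := prime_gt1 pr_p; move: dvd_p.
by rewrite /cofactor -addn1 dvdn_addr // dvdn1 => /eqP ->.
Qed.

Lemma ptf_window (k j r : nat) : 0 < j <= k ->
    (forall p, k < p -> ~~ (p ^ 2 %| cofactor k j r)) ->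
  ptf (k`! * k`! * r + j) =
    PNode ([seq ptf (logn p j) | p <- primes j]
           ++ nseq (size (primes (cofactor k j r))) (ptf 1)).
Proof.
move=> jk sqf; rewrite cofactorE // ptf_mul_squarefree //; first by case/andP: jk.
  move=> p q; rewrite mem_primes => /and3P[_ j0 dvd_pj] /cofactor_prime_gt.
  by apply: leq_ltn_trans; apply: leq_trans (dvdn_leq j0 dvd_pj) (andP jk).2.
by move=> p /cofactor_prime_gt; exact: sqf.
Qed.

(** The sieve runs over all integers [p] in [(k, Y]], prime or not, so that the union bound is a
    plain sum of inverse squares. *)
Definition squarefree_window (k Q Y : nat) : {set 'I_Q} :=
  [set r : 'I_Q | [forall j : 'I_k, forall p : 'I_Y.+1,
     (k < p) ==> ~~ (p ^ 2 %| cofactor k j.+1 r)]].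

(** The union bound discards at most [k * (2 * Q / (2 * k + 1) + Y)] values of [r], and
    [1 - 2k / (2k + 1) = 1 / (2k + 1)] of [Q] survives the main term. *)
Lemma card_squarefree_window (k Q Y : nat) :
  Q <= (k.*2.+1) * (#|squarefree_window k Q Y| + k * Y).
Proof.
set G := squarefree_window k Q Y.
have cardC : #|~: G| <= k * \sum_(k.+1 <= m < Y.+1) (Q %/ m ^ 2).+1.
  pose B (j : 'I_k) (p : 'I_Y.+1) :=
    [set r : 'I_Q | p ^ 2 %| cofactor k j.+1 r].
  have sub : ~: G \subset \bigcup_j \bigcup_(p : 'I_Y.+1 | k < p) B j p.
    apply/fintype.subsetP => r; rewrite !inE => /forallPn[j /forallPn[p]].
    rewrite negb_imply negbK => /andP[kp dvd_p].
    by apply/finset.bigcupP; exists j => //; apply/finset.bigcupP; exists p; rewrite ?inE.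
  apply: leq_trans (subset_leq_card sub) _.
  apply: leq_trans (card_bigcup_leq _ _) _.
  rewrite -[k in k * _]card_ord -sum_nat_const; apply: leq_sum => j _.
  apply: leq_trans (card_bigcup_leq _ _) _.
  rewrite (big_nat_widenl _ 0) // big_mkord.
  by apply: leq_sum => p _; exact: card_dvdn_affine.
rewrite -(ler_nat rat).
have cardQ : #|G| + #|~: G| = Q by rewrite cardsC card_ord.
have : (Q%:R <= #|G|%:R + k%:R * (Q%:R * (2 / (2 * k%:R + 1)) + Y%:R) :> rat)%R.
  rewrite -{1}cardQ natrD lerD2l.
  apply: le_trans (_ : ((k * \sum_(k.+1 <= m < Y.+1) (Q %/ m ^ 2).+1)%:R <= _)%R).
    by rewrite ler_nat.
  rewrite natrM ler_wpM2l ?ler0n // natr_sum.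
  apply: (@le_trans _ _ (\sum_(k.+1 <= m < Y.+1) (Q%:R * ((m ^ 2)%:R)^-1 + 1))%R).
    rewrite big_nat [leRHS]big_nat; apply: ler_sum => m /andP[km _].
    rewrite -natr1 lerD2r ler_pdivlMr ?ltr0n ?expn_gt0 ?(leq_ltn_trans _ km) //.
    by rewrite -natrM ler_nat leq_divM.
  rewrite big_split /= -mulr_sumr lerD //.
    by rewrite ler_wpM2l ?ler0n // sum_inv_sqr_leq.
  by rewrite sumr_const_nat ler_nat; lia.
rewrite natrM natrD natrM.
have -> : (k.*2.+1%:R = 2 * k%:R + 1 :> rat)%R by rewrite -natr1 -muln2 natrM mulrC.
set q : rat := Q%:R%R; set g : rat := #|G|%:R%R; set c : rat := k%:R%R.
set y : rat := Y%:R%R => le_q.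
have c0 : (0 <= c)%R by rewrite ler0n.
have c1 : (0 < 2 * c + 1)%R by lra.
have : (q * (2 * c + 1) <= (g + c * (q * (2 / (2 * c + 1)) + y)) * (2 * c + 1))%R.
  by rewrite ler_pM2r.
have -> : ((g + c * (q * (2 / (2 * c + 1)) + y)) * (2 * c + 1) =
          (g + c * y) * (2 * c + 1) + 2 * c * q)%R.
  by field; rewrite lt0r_neq0.
by lra.
Qed.

(** The middle term counts patterns: each of the [k] cofactors is at most [M * Q], so its number of
    primes lies between 0 and the binary logarithm. *)
Lemma many_large_kappa_plus (k Q Y : nat) (M := k`! * k`!) :
    0 < k -> M * Q < Y.+1 ^ 2 ->
  exists s : seq nat,
    [/\ uniq s,
        forall n, n \in s -> [/\ 0 < n, n <= M * Q & k <= kappa_plus n]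
      & Q <= k.*2.+1 * (size s + (trunc_log 2 (M * Q)).+1 ^ k + k * Y)].
Proof.
move=> k0 ltY; set L := trunc_log 2 (M * Q).
have M0 : 0 < M by rewrite muln_gt0 fact_gt0.
have kM : k <= M.
  by rewrite dvdn_leq // dvdn_mulr // dvdn_fact // k0 leqnn.
have le_win (r : 'I_Q) j : 0 < j <= k -> M * r + j <= M * Q.
  move=> /andP[_ jk]; apply: (@leq_trans (M * r.+1)).
    by rewrite mulnS addnC leq_add2r (leq_trans jk).
  by rewrite leq_mul2l ltn_ord orbT.
have le_cof (r : 'I_Q) j : 0 < j <= k -> cofactor k j r <= M * Q.
  move=> jk; apply: leq_trans (le_win r j jk); rewrite cofactorE //.
  by rewrite leq_pmull //; case/andP: jk.
set G := squarefree_window k Q Y.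
have GP (r : 'I_Q) j : r \in G -> 0 < j <= k ->
    ptf (M * r + j) = PNode ([seq ptf (logn p j) | p <- primes j]
       ++ nseq (size (primes (cofactor k j r))) (ptf 1)).
  move=> rG jk; apply: ptf_window => // p kp; apply/negP => dvd_p.
  (* A square dividing a cofactor is at most [M * Q], so the sieve up to [Y] misses none. *)
  have ltp : p < Y.+1.
    rewrite -(@ltn_exp2r _ _ 2) //; apply: leq_ltn_trans ltY.
    by apply: leq_trans (dvdn_leq _ dvd_p) (le_cof r j jk).
  have ltj : j.-1 < k by lia.
  move: rG; rewrite inE => /forallP/(_ (Ordinal ltj))/forallP/(_ (Ordinal ltp)).
  by rewrite /= prednK ?kp /= ?dvd_p //; case/andP: jk.
(* [inord] has a default value outside its range; [lt_size] below shows that it is never taken. *)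
pose f (r : 'I_Q) : {ffun 'I_k -> 'I_L.+1} :=
  [ffun j : 'I_k => inord (size (primes (cofactor k j.+1 r)))].
have := card_noninjective G f; set S := [set _ in G | _].
rewrite card_ffun !card_ord => cardG.
(* Starting at [M * r + 1] makes the offsets [i < k] correspond to [j = i + 1] in [1..k]. *)
exists [seq M * r + 1 | r : 'I_Q <- enum S]; split.
- rewrite map_inj_uniq ?enum_uniq // => r r' /eqP.
  by rewrite eqn_add2r eqn_pmul2l // => /eqP/val_inj.
- move=> n /mapP[r]; rewrite mem_enum inE => /andP[rG].
  move=> /existsP[r' /and3P[r'G neq_r /eqP eq_f]] ->.
  split; [by rewrite addn1|exact: le_win|].
  apply: (@kappa_plus_ge _ (M * r' + 1)); first by rewrite addn1.
    by rewrite eqn_add2r eqn_pmul2l.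
  move=> i ik; rewrite -!addnA !add1n !GP //.
  congr (PNode (_ ++ nseq _ _)).
  have lt_size (t : 'I_Q) : size (primes (cofactor k i.+1 t)) < L.+1.
    rewrite ltnS; apply: trunc_log_max => //.
    by apply: leq_trans (exp2_size_primes _) _ => //; exact: le_cof.
  have := congr1 (fun g : {ffun _} => g (Ordinal ik)) eq_f.
  by rewrite !ffunE /= => /(congr1 val); rewrite /= !inordK.
rewrite size_map -cardE.
apply: leq_trans (card_squarefree_window k Q Y) _.
by rewrite leq_mul2l leq_add2r cardG.
Qed.

(** * Logarithms and the choice of parameters *)

Local Open Scope ring_scope.

Lemma ln2_ge_half (R : realType) : 1 / 2 <= ln 2 :> R.
Proof.
have /le_ln1Dx : (-1 < - (1 / 2) :> R) by lra.
have -> : 1 + - (1 / 2) = 2^-1 :> R by field.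
by rewrite lnV ?posrE //; lra.
Qed.

Lemma trunc_log2_le_ln (R : realType) (n : nat) : (0 < n)%N ->
  (trunc_log 2 n)%:R <= 2 * ln n%:R :> R.
Proof.
move=> n0; have := trunc_logP (isT : 1 < 2)%N n0.
rewrite -(ler_nat R) natrX; set L := trunc_log 2 n => le_n.
have : ln (2 ^+ L) <= ln n%:R :> R.
  by rewrite ler_ln ?posrE ?ltr0n ?exprn_gt0.
rewrite lnXn // -[ln 2 *+ L]mulr_natl => le_ln.
have : L%:R * (1 / 2) <= L%:R * ln 2 :> R.
  by rewrite ler_wpM2l ?ler0n ?ln2_ge_half.
lra.
Qed.

Theorem theorem1 (R : realType) :
  exists x0 : R, forall x : R, x0 <= x ->
  forall k : nat, (1 <= k)%N -> k%:R <= ln x / (5 * ln (ln x)) ->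
  exists s : seq nat,
    [/\ uniq s,
        forall n : nat, n \in s ->
          [/\ (1 <= n)%N, n%:R <= x & (k <= kappa_plus n)%N]
      & x `^ (1 / 10) <= (size s)%:R].
Proof.
exists (expR 2000) => x le_x k k1 le_k.
have x0 : 0 < x by apply: lt_le_trans le_x; rewrite expR_gt0.
set l := ln x in le_k.
have l_ge : 2000 <= l by rewrite -(expRK 2000) ler_ln ?posrE ?expR_gt0.
have xE : x = expR l by rewrite lnK.
have ll1 : 1 <= ln l.
  have : ln (2 ^+ 2) <= ln l by rewrite ler_ln ?posrE; lra.
  by rewrite lnXn // mulr2n; have := ln2_ge_half R; lra.
have kll : k%:R * ln l <= l / 5.
  move: le_k; rewrite ler_pdivlMr; first by lra.
  by lra.
have kl : k%:R <= l.
  have : 0 <= k%:R * (ln l - 1) by rewrite mulr_ge0 ?ler0n //; lra.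
  by lra.
have l0 : 0 < l by lra.
(* Here [z] is the tenth root of [x], and all sizes are compared with powers of [z]. *)
set z := expR (l / 10).
have z0 : 0 < z by apply: expR_gt0.
have zE m : z ^+ m = expR (l * m%:R / 10).
  by rewrite -expRM_natr; congr expR; ring.
have z_ge : 10 * l ^+ 2 <= z.
  have a_ge : 200 <= l / 10 by lra.
  have := @expR_ge1Dxn R (l / 10) 3 ltac:(lra); rewrite -/z.
  have -> : 4`! = 24%N by [].
  have -> : 10 * l ^+ 2 = 1000 * (l / 10) ^+ 2 by field.
  move: (l / 10) a_ge => a a_ge; apply: le_trans.
  have -> : a ^+ 4 = a ^+ 2 * a ^+ 2 by ring.
  have : 200 * a <= a ^+ 2 by rewrite expr2 ler_wpM2r; lra.
  move: (a ^+ 2) => b le_b.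
  have : 200 * 120 * b <= b * b by rewrite ler_wpM2r; lra.
  by lra.
have xz : x = z ^+ 10 by rewrite zE xE; congr expR; field.
have powx : x `^ (1 / 10) = z.
  by rewrite /powR gt_eqF // /z -/l; congr expR; field.
(* The constant 5 of the hypothesis enters here: [k * ln l <= l / 5]. *)
have lkz : l ^+ k <= z ^+ 2.
  rewrite -[l in l ^+ _]lnK ?posrE // -expRM_natl zE ler_expR.
  by lra.
pose M := (k`! * k`!)%N; pose N := Num.trunc x; pose Q := (N %/ M)%N.
have M0 : (0 < M)%N by rewrite muln_gt0 fact_gt0.
have kfz : k`!%:R <= z ^+ 2.
  apply: le_trans lkz; apply: (@le_trans _ _ (k ^ k)%:R).
    by rewrite ler_nat fact_leq_exp.
  by rewrite natrX lerXn2r ?nnegrE ?ler0n // ltW.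
(* This leaves about [z ^+ 6] windows, against at most [z ^+ 4] patterns and a sieve error near
   [z ^+ 5]. *)
have Mz : M%:R <= z ^+ 4.
  by rewrite natrM (_ : z ^+ 4 = z ^+ 2 * z ^+ 2) ?ler_pM ?ler0n //; ring.
have MQN : (M * Q <= N)%N by rewrite mulnC leq_divM.
have Nx : N%:R <= x by rewrite truncn_le ltW.
have MQx : (M * Q)%:R <= x by apply: le_trans Nx; rewrite ler_nat.
have Qz : z ^+ 6 <= Q%:R + 1.
  have : x < (M * Q.+1)%:R.
    apply: lt_le_trans (truncnS_gt x) _; rewrite ler_nat.
    by rewrite mulnC; apply: ltn_ceil.
  rewrite natrM -natr1 xz => ltz.
  have : z ^+ 10 <= z ^+ 4 * (Q%:R + 1).
    apply: ltW; apply: lt_le_trans ltz _.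
    by rewrite ler_wpM2r // addr_ge0 // ler0n.
  have -> : z ^+ 10 = z ^+ 4 * z ^+ 6 by ring.
  by rewrite ler_pM2l // exprn_gt0.
pose Y := Num.trunc (z ^+ 5).
have z5 : 0 < z ^+ 5 by rewrite exprn_gt0.
have Yz : Y%:R <= z ^+ 5 by rewrite truncn_le ltW.
have ltY : (M * Q < Y.+1 ^ 2)%N.
  rewrite -(ltr_nat R); apply: le_lt_trans MQx _.
  rewrite natrX xz (_ : z ^+ 10 = (z ^+ 5) ^+ 2); last by ring.
  by rewrite ltrXn2r ?nnegrE ?ler0n ?ltW // truncnS_gt.
have [s [uniq_s s_kappa]] := many_large_kappa_plus k1 ltY.
rewrite -/M; set L := trunc_log 2 _ => le_Q.
exists s; split=> //.
  move=> n /s_kappa[n0 le_n kn]; split=> //.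
  by apply: le_trans MQx; rewrite ler_nat.
(* With fewer than [z] integers, [Q] would be at most [3 * l * (z + z ^+ 4 + l * z ^+ 5)], whereas
   [z ^+ 6] is at least [10 * l ^+ 2 * z ^+ 5]. *)
rewrite powx leNgt; apply/negP => lt_s.
have z1 : 1 <= z by nra.
have LQ : L.+1%:R <= l ^+ 2.
  (* The logarithm bound needs a positive argument, so [Q = 0] is treated apart. *)
  have [MQ0|MQ0] := posnP (M * Q)%N.
    by rewrite /L MQ0 trunc_log0; nra.
  have := trunc_log2_le_ln R MQ0; rewrite -/L -natr1.
  have : ln (M * Q)%:R <= l by rewrite ler_ln ?posrE ?ltr0n.
  by nra.
have Lkz : (L.+1 ^ k)%:R <= z ^+ 4.
  rewrite natrX; apply: (@le_trans _ _ ((l ^+ 2) ^+ k)).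
    by rewrite lerXn2r ?nnegrE ?ler0n ?exprn_ge0 // ltW.
  rewrite exprAC (_ : z ^+ 4 = (z ^+ 2) ^+ 2); last by ring.
  by rewrite lerXn2r ?nnegrE ?exprn_ge0 // ltW.
have kYz : (k * Y)%:R <= l * z ^+ 5 by rewrite natrM ler_pM ?ler0n.
have k2l : k.*2.+1%:R <= 3 * l :> R.
  by rewrite -natr1 -muln2 natrM; lra.
have : Q%:R <= 3 * l * (z + z ^+ 4 + l * z ^+ 5).
  move: le_Q; rewrite -(ler_nat R) natrM !natrD => /le_trans; apply.
  by rewrite ler_pM ?ler0n ?addr_ge0 ?ler0n // !lerD // ltW.
have zz m : (m <= 5)%N -> z ^+ m <= z ^+ 5 by move=> ?; rewrite ler_weXn2l.
have := zz 0%N isT; have := zz 1%N isT; have := zz 4%N isT.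
have : 10 * l ^+ 2 * z ^+ 5 <= z ^+ 6 by rewrite [z ^+ 6]exprSr mulrC ler_pM2l.
move: Qz; rewrite expr0 expr1 expr2.
move: (z ^+ 6) (z ^+ 5) (z ^+ 4) z5 => z6 w v w0 Qz le_z6 le_v le_z le_1 le_Qz.
have : 3 * l * (z + v + l * w) <= 3 * l * ((l + 2) * w).
  by rewrite ler_pM2l; lra.
have : 2000 * (l * w) <= l * (l * w) by rewrite ler_pM2r // mulr_gt0.
have : 2000 * w <= l * w by rewrite ler_pM2r.
by lra.
Qed.
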